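(* Let $A$ be a graded commutative dg $R$-algebra and let $M$ be a dg $A$-module with $M_i=0$ for all $i<0$. Suppose there is a homomorphism of dg $A$-modules $\beta: M\to A$ such that the induced homomorphism $\theta: M\otimes M\to M$ given by $\theta(m\otimes n)=m\beta(n)-\beta(m)n$ is nullhomotopic via an $A$-linear homotopy $\mu: M\otimes M\to M$ satisfying $\beta\mu=0$ and $$\mu(\mu(m\otimes n)\otimes u)=-(-1)^{|m|}\mu(m\otimes\mu(n\otimes u))$$ for all homogeneous $m,n,u\in M$. Then $C=\operatorname{Cone}(\beta)$ is a dg $R$-algebra with multiplication defined by $$(a,m)(b,n)=\bigl(ab,\; mb+(-1)^{|a|}an+(-1)^{|m|}\mu(m\otimes n)\bigr)$$ for all homogeneous $(a,m),(b,n)\in C$ of degree at least $1$. Moreover, $C$ is graded commutative if $\mu$ satisfies $$\mu(m\otimes n)=-(-1)^{|m||n|}\mu(n\otimes m)\quad\text{for all homogeneous } m,n\in M,$$ and $C$ is strictly commutative if $\mu$ additionally satisfies $\mu(m\otimes m)=0$ for all homogeneous $m\in M$ with $|m|$ even.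
   Context: $R$ is a commutative ring. A graded $R$-algebra is a $\mathbb{Z}$-graded (associative, unital) ring $A$ with $A_i=0$ for $i<0$ and $A_0=R$. It is graded commutative if $ab=(-1)^{|a||b|}ba$ for all homogeneous $a,b$, and strictly commutative if moreover $a^2=0$ for all homogeneous $a$ of odd degree. A dg $R$-algebra is a graded $R$-algebra with a differential $\partial$ ($R$-linear, degree $-1$, $\partial^2=0$) satisfying $\partial(ab)=\partial(a)b+(-1)^{|a|}a\partial(b)$ for homogeneous $a,b$. A (left) dg $A$-module is a graded left $A$-module $M$ with a differential $\partial^M$ of degree $-1$ (with square zero) satisfying $\partial^M(am)=\partial^A(a)m+(-1)^{|a|}a\partial^M(m)$. As $A$ is graded commutative, $M$ is also a right dg $A$-module via $ma=(-1)^{|a||m|}am$. A graded $R$-linear map $f:M\to N$ of degree $s$ is $A$-linear if $f(am)=(-1)^{|a|s}af(m)$ (equivalently $f(ma)=f(m)a$). A homomorphism of dg modules is an $A$-linear chain map of degree $0$. $M\otimes N$ denotes the tensor product over $A$: the quotient of $M\otimes_R N$ by the elements $ma\otimes n-m\otimes an$, with differential $\partial(m\otimes n)=\partial m\otimes n+(-1)^{|m|}m\otimes\partial n$ and right $A$-action $(m\otimes n)a=m\otimes na$. The map $\theta$ in the statement is a well-defined homomorphism of dg $A$-modules. ''Nullhomotopic via an $A$-linear homotopy $\mu$'' means that $\mu$ is an $A$-linear map of degree $1$ with $\partial^M\mu+\mu\partial^{M\otimes M}=\theta$. The mapping cone $C=\operatorname{Cone}(\beta)$ has $C_i=A_i\oplus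 M_{i-1}$ and differential $\partial^C(a,m)=(\partial^A(a)+\beta(m),-\partial^M(m))$; in particular $C_0=A_0=R$, and a homogeneous element $(a,m)$ has $|a|=|m|+1$. Multiplication by elements of $C_0=R$ is given by the natural $R$-module structure.
   Formalization: The last claim (C strictly commutative) additionally assumes A strictly commutative; without it the claim fails (R = F_2, A = F_2[x] with |x| = 1 and zero differential, M = 0), and it is necessary since (a,0)(a,0) = (a^2,0). *)

(* Defs.v *)
From HB Require Import structures.
From mathcomp Require Import all_boot all_order all_algebra.
From mathcomp Require Import generic_quotient ring_quotient finmap.
From mathcomp Require Import boolp classical_sets functions cardinality fsbigop.
From mathcomp Require Import zify ring.

Set Implicit Arguments.
Unset Strict Implicit.
Unset Printing Implicit Defensive.

Import Order.TTheory GRing.Theory Num.Theory.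
Local Open Scope classical_set_scope.
Local Open Scope ring_scope.

Section Linear.
Variable R : pzRingType.

Definition bilin (U V W : lmodType R) (f : U -> V -> W) :=
  (forall v, linear (f^~ v)) /\ (forall u, linear (f u)).

Lemma linearD' (U V : lmodType R) (f : U -> V) : linear f ->
  forall x y, f (x + y) = f x + f y.
Proof. by move=> lf x y; rewrite -[x in LHS]scale1r lf scale1r. Qed.

Lemma linear0' (U V : lmodType R) (f : U -> V) : linear f -> f 0 = 0.
Proof.
by move=> lf; apply: (addrI (f 0)); rewrite -linearD' // !addr0.
Qed.

Lemma linearZ' (U V : lmodType R) (f : U -> V) : linear f ->
  forall r x, f (r *: x) = r *: f x.
Proof. by move=> lf r x; rewrite -[r *: x]addr0 lf linear0' // addr0. Qed.

Lemma linearN' (U V : lmodType R) (f : U -> V) : linear f ->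
  forall x, f (- x) = - f x.
Proof. by move=> lf x; rewrite -scaleN1r linearZ' // scaleN1r. Qed.

Lemma linear_comp' (U V W : lmodType R) (f : V -> W) (g : U -> V) :
  linear f -> linear g -> linear (fun x => f (g x)).
Proof. by move=> lf lg r x y; rewrite lg lf. Qed.

Lemma linear_cst0 (U V : lmodType R) : linear (fun _ : U => 0 : V).
Proof. by move=> r x y; rewrite scaler0 addr0. Qed.

Lemma fsum_seq (I : choiceType) (V : zmodType) (D : set I) (F : I -> V) :
  finite_set D -> (forall i, ~ D i -> F i = 0) ->
  \sum_(i \in [set: I]) F i = \sum_(i <- fset_set D) F i.
Proof.
move=> fD DF; apply: fsbigTE => i.
by rewrite in_fset_set // notin_setE => /DF.
Qed.

Lemma linear_fsum (I : choiceType) (U V : lmodType R) (f : U -> V) (c : I -> U) :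
  linear f -> finite_set [set i | c i != 0] ->
  f (\sum_(i \in [set: I]) c i) = \sum_(i \in [set: I]) f (c i).
Proof.
move=> lf fc; have cN i : ~ [set i | c i != 0] i -> c i = 0.
  by move=> /= /negP; rewrite negbK => /eqP.
rewrite (fsum_seq fc cN) (@fsum_seq _ _ _ (f \o c) fc); last first.
  by move=> i /cN /= ->; rewrite linear0'.
elim/big_ind2: _ => //; first exact: linear0'.
by move=> _ x _ y <- <-; rewrite linearD'.
Qed.

Lemma fsum1 (I : choiceType) (V : zmodType) (i : I) (F : I -> V) :
  (forall j, j != i -> F j = 0) -> \sum_(j \in [set: I]) F j = F i.
Proof.
move=> F0; rewrite (@fsum_seq _ _ [set i]) ?fset_set1 ?big_seq_fset1 //.
by move=> j /eqP; apply: F0.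
Qed.

End Linear.

Section Span.
Variables (R : pzRingType) (V : lmodType R) (S : set V).

Definition gspan : {pred V} := fun v =>
  `[< forall U : {pred V}, submod_closed U -> (forall s, S s -> s \in U) ->
      v \in U >].

Lemma span_submod_closed : submod_closed gspan.
Proof.
split; first by apply/asboolP => U [].
move=> r x y /asboolP Sx /asboolP Sy; apply/asboolP => U cU SU.
by apply: cU.2; [apply: Sx|apply: Sy].
Qed.

HB.instance Definition _ := GRing.isSubmodClosed.Build R V gspan
  span_submod_closed.

Lemma mem_span s : S s -> s \in gspan.
Proof. by move=> Ss; apply/asboolP => U _; apply. Qed.

Lemma span_sub (U : {pred V}) : submod_closed U -> (forall s, S s -> s \in U) ->
  {subset gspan <= U}.
Proof. by move=> cU SU x /asboolP; apply. Qed.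

Lemma span_ind (P : V -> Prop) : P 0 ->
  (forall r x y, P x -> P y -> P (r *: x + y)) -> (forall s, S s -> P s) ->
  forall v, v \in gspan -> P v.
Proof.
move=> P0 PD PS v /(@span_sub (fun v => `[< P v >])) H; apply/asboolP/H.
- split; first exact/asboolP.
  by move=> r x y /asboolP Px /asboolP Py; apply/asboolP/PD.
- by move=> s Ss; apply/asboolP/PS.
Qed.

Definition quotm := Quotient.quot gspan.
HB.instance Definition _ := GRing.Zmodule.on quotm.
HB.instance Definition _ := ZmodQuotient.on quotm.

Definition qproj (v : V) : quotm := \pi_(Quotient.quot gspan)%qT v.

Lemma projP x y : qproj x = qproj y <-> x - y \in gspan.
Proof.
rewrite /qproj Quotient.idealrBE; split=> [e|/eqP e]; [exact/eqP|exact: e].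
Qed.

Lemma proj_surj (q : quotm) : exists v, q = qproj v.
Proof. by exists (repr q); rewrite /qproj reprK. Qed.

Lemma projD : {morph qproj : x y / x + y}.
Proof. by move=> x y; rewrite /qproj !piE. Qed.

Definition quot_scale (r : R) (q : quotm) : quotm := qproj (r *: repr q).

Lemma quot_scale_proj r v : quot_scale r (qproj v) = qproj (r *: v).
Proof.
by apply/projP; rewrite -scalerBr rpredZ //; apply/projP; rewrite /qproj reprK.
Qed.

Fact quot_scalerA a b q : quot_scale a (quot_scale b q) = quot_scale (a * b) q.
Proof. by have [v ->] := proj_surj q; rewrite !quot_scale_proj scalerA. Qed.
Fact quot_scale1r : left_id 1 quot_scale.
Proof. by move=> q; have [v ->] := proj_surj q; rewrite quot_scale_proj scale1r. Qed.
Fact quot_scalerDr : right_distributive quot_scale +%R.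
Proof.
move=> a p q; have [v ->] := proj_surj p; have [w ->] := proj_surj q.
by rewrite -projD !quot_scale_proj -projD scalerDr.
Qed.
Fact quot_scalerDl q : {morph quot_scale^~ q : a b / a + b}.
Proof.
move=> a b; have [v ->] := proj_surj q.
by rewrite !quot_scale_proj -projD scalerDl.
Qed.

HB.instance Definition _ := GRing.Zmodule_isLmodule.Build R quotm
  quot_scalerA quot_scale1r quot_scalerDr quot_scalerDl.

Lemma proj_linear : linear qproj.
Proof.
move=> r x y; rewrite projD; congr (_ + _).
exact/esym/quot_scale_proj.
Qed.

Lemma proj_eq0 v : v \in gspan -> qproj v = 0.
Proof.
move=> Sv; rewrite -(linear0' proj_linear).
by apply/projP; rewrite subr0.
Qed.

Definition quot_lift (W : lmodType R) (f : V -> W) (q : quotm) := f (repr q).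

Lemma quot_lift_proj (W : lmodType R) (f : V -> W) :
  linear f -> (forall s, S s -> f s = 0) ->
  forall v, quot_lift f (qproj v) = f v.
Proof.
move=> lf f0 v; apply/eqP; rewrite -subr_eq0; apply/eqP.
have fB x y : f x - f y = f (x - y).
  by rewrite -[- y]scaleN1r linearD' // linearZ' // scaleN1r.
rewrite fB; set w := _ - v.
have : w \in gspan by apply/projP; rewrite /qproj reprK.
elim/span_ind: w / => [|r x y fx fy|//]; first exact: linear0'.
by rewrite lf fx fy scaler0 addr0.
Qed.

Lemma quot_lift_linear (W : lmodType R) (f : V -> W) :
  linear f -> (forall s, S s -> f s = 0) -> linear (quot_lift f).
Proof.
move=> lf f0 r p q; have [v ->] := proj_surj p; have [w ->] := proj_surj q.
by rewrite -(proj_linear r v w) !quot_lift_proj // lf.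
Qed.

End Span.

Section FreeModule.
Variables (R : pzRingType) (X : choiceType).

Definition finsupp : {pred X -> R^o} :=
  fun f => `[< finite_set [set x | f x != 0] >].

Lemma finsupp_submod_closed : submod_closed finsupp.
Proof.
split.
  by apply/asboolP; apply: (sub_finite_set _ (finite_set0 X)) => x /=; rewrite eqxx.
move=> r f g /asboolP ff /asboolP fg; apply/asboolP.
have /sub_finite_set : [set x | (r *: f + g) x != 0] `<=`
    [set x | f x != 0] `|` [set x | g x != 0].
  move=> x /= H; apply/orP; apply: contraNT H.
  rewrite negb_or !negbK => /andP[/eqP f0 /eqP g0].
  by rewrite /GRing.add /GRing.scale /= f0 g0 scaler0 addr0.
by apply; rewrite finite_setU.
Qed.

HB.instance Definition _ := GRing.isSubmodClosed.Build R (X -> R^o) finsupp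
  finsupp_submod_closed.

Record freem := Freem { free_val :> X -> R^o; _ : free_val \in finsupp }.
HB.instance Definition _ := [isSub for free_val].
HB.instance Definition _ := [Choice of freem by <:].
HB.instance Definition _ := [SubChoice_isSubLmodule of freem by <:].

Fact free_gen_subproof (x : X) : (fun y => (y == x)%:R : R^o) \in finsupp.
Proof.
apply/asboolP; apply: (sub_finite_set _ (finite_set1 x)) => y /=.
by case: (y =P x) => //; rewrite eqxx.
Qed.
Definition free_gen x : freem := Freem (free_gen_subproof x).

Definition free_lift (W : lmodType R) (g : X -> W) (f : freem) : W :=
  \sum_(x \in [set: X]) (f x : R) *: g x.

Lemma finite_supp (f : freem) : finite_set [set x | f x != 0].
Proof. by have /asboolP := valP f. Qed.

Lemma free_lift_gen (W : lmodType R) (g : X -> W) x :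
  free_lift g (free_gen x) = g x.
Proof.
rewrite /free_lift (fsum1 (i := x)) /= ?eqxx; first exact: scale1r.
by move=> y /negPf ->; rewrite scale0r.
Qed.

Lemma free_valE r (f h : freem) x : (r *: f + h) x = r * f x + h x :> R.
Proof.
have := congr1 (fun F : X -> R^o => F x) (linearP (\val : freem -> _) r f h).
exact.
Qed.

Lemma free_lift_linear (W : lmodType R) (g : X -> W) : linear (free_lift g).
Proof.
move=> r f h; set D := [set x | f x != 0] `|` [set x | h x != 0].
have fD : finite_set D by rewrite finite_setU; split; apply: finite_supp.
have DP x : ~ D x -> f x = 0 /\ h x = 0.
  by move/not_orP => /= [/negP + /negP]; rewrite !negbK => /eqP + /eqP.
rewrite /free_lift !(fsum_seq fD); first last.
- move=> x /DP[f0 h0]; rewrite (free_valE r f h x) f0 h0 mulr0 addr0; exact: scale0r.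
- by move=> x /DP[-> _]; exact: scale0r.
- by move=> x /DP[_ ->]; exact: scale0r.
rewrite scaler_sumr -big_split; apply: eq_bigr => x _ /=.
by rewrite [X in X *: g x](_ : _ = r * f x + h x :> R) // scalerDl scalerA.
Qed.

Lemma free_val_sum (s : seq X) (F : X -> freem) y :
  (\sum_(x <- s) F x) y = \sum_(x <- s) F x y.
Proof.
elim: s => [|x s IH]; first by rewrite !big_nil.
by rewrite !big_cons -IH -[F x]scale1r free_valE mul1r scale1r.
Qed.

Lemma free_span (f : freem) :
  f = \sum_(x \in [set: X]) (f x : R) *: free_gen x.
Proof.
have fN x : ~ [set x | f x != 0] x -> f x = 0.
  by move=> /= /negP; rewrite negbK => /eqP.
rewrite (fsum_seq (finite_supp f)); last by move=> x /fN ->; exact: scale0r.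
apply: val_inj; apply/funext => y; rewrite [RHS]free_val_sum.
have E x : ((f x : R) *: free_gen x) y = f x * (y == x)%:R.
  by rewrite -[_ *: _]addr0 free_valE addr0.
under eq_bigr do rewrite E.
rewrite -(@fsum_seq _ _ _ (fun x => f x * (y == x)%:R : R^o)).
- rewrite (fsum1 (i := y)) ?eqxx ?mulr1 // => x.
  by rewrite eq_sym => /negPf ->; rewrite mulr0.
- exact: finite_supp.
- by move=> x /fN ->; rewrite mul0r.
Qed.

End FreeModule.

Section Sign.
Variable R : pzRingType.

Definition sgn (i : int) : R := (-1) ^+ `|i|%N.

Lemma sgnE i j k : i = j + k *+ 2 -> sgn i = sgn j.
Proof.
rewrite /sgn -(signr_odd _ `|i|) -(signr_odd _ `|j|) => e.
by congr (_ ^+ nat_of_bool _); lia.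
Qed.

Lemma sgnD i j : sgn (i + j) = sgn i * sgn j.
Proof.
rewrite /sgn -exprD -(signr_odd _ `|_|) -(signr_odd _ (_ + _)).
by congr (_ ^+ nat_of_bool _); lia.
Qed.

Lemma sgn0 : sgn 0 = 1. Proof. by []. Qed.

Lemma sgnK (V : lmodType R) i (v : V) : sgn i *: (sgn i *: v) = v.
Proof. by rewrite scalerA -sgnD (@sgnE _ 0 i) ?sgn0 ?scale1r // add0r mulr2n. Qed.

End Sign.

Section Grading.
Variables (R : pzRingType) (V : lmodType R).

(* [v] is the sum of the finitely supported family [c] with [c i \in G i]; a
   grading is an internal direct sum decomposition of [V] into submodules. *)
Definition decomposition (G : int -> {pred V}) (v : V) (c : int -> V) :=
  [/\ forall i, c i \in G i, finite_set [set i | c i != 0] &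
      v = \sum_(i \in [set: int]) c i].

Definition is_grading (G : int -> {pred V}) :=
  (forall i, submod_closed (G i)) /\
  (forall v, exists! c, decomposition G v c).

Variable G : int -> {pred V}.

Lemma decomposition_lin (r : R) u v c d :
  (forall i, submod_closed (G i)) ->
  decomposition G u c -> decomposition G v d ->
  decomposition G (r *: u + v) (fun i => r *: c i + d i).
Proof.
move=> cG [cG1 fc ->] [dG fd ->].
have fD : finite_set ([set i | c i != 0] `|` [set i | d i != 0]).
  by rewrite finite_setU.
have DP i : ~ ([set i | c i != 0] `|` [set i | d i != 0]) i -> c i = 0 /\ d i = 0.
  by move/not_orP => /= [/negP + /negP]; rewrite !negbK => /eqP + /eqP.
split=> [i||].
- exact: (cG i).2.
- apply: sub_finite_set fD => i /= H; apply: contrapT => /DP[c0 d0].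
  by move: H; rewrite c0 d0 scaler0 addr0 eqxx.
- rewrite !(fsum_seq fD).
  + by rewrite scaler_sumr -big_split.
  + by move=> i /DP[-> ->]; rewrite scaler0 addr0.
  + by move=> i /DP[].
  + by move=> i /DP[].
Qed.

Lemma decomposition_homog i v : (forall i, submod_closed (G i)) -> v \in G i ->
  decomposition G v (fun j => if j == i then v else 0).
Proof.
move=> cG vi; split=> [j||].
- by case: eqP => [->//|_]; apply: (cG j).1.
- apply: (sub_finite_set _ (finite_set1 i)) => j /=.
  by case: (j =P i) => // _; rewrite eqxx.
- by rewrite (fsum1 (i := i)) ?eqxx // => j /negPf ->.
Qed.

Lemma grading_of_proj (p : int -> V -> V) :
  (forall i, submod_closed (G i)) -> (forall i, linear (p i)) ->
  (forall i j v, v \in G j -> p i v = if i == j then v else 0) ->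
  (forall v, v \in gspan [set x | exists i, x \in G i]) ->
  is_grading G.
Proof.
move=> cG lp pG sG; split=> // v.
have [c dc] : exists c, decomposition G v c.
  elim/span_ind: v / (sG v) => [|r x y [c dc] [d dd]|x /= [i xi]].
  - by exists (fun j => if j == 0 then 0 else 0); apply: decomposition_homog (cG 0).1.
  - by eexists; apply: decomposition_lin dc dd.
  - by eexists; apply: decomposition_homog xi.
exists c; split=> // d dd; suff H e : decomposition G v e -> forall i, e i = p i v.
  by apply/funext => i; rewrite (H c) // (H d).
case=> eG fe -> i; rewrite linear_fsum // (fsum1 (i := i)) ?(pG i i) ?eqxx //.
by move=> j ji; rewrite (pG i j) // eq_sym (negPf ji).
Qed.

Definition hcomp (v : V) : int -> V := xget (fun=> 0) (decomposition G v).

Hypothesis gG : is_grading G.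

Lemma hcompP v : decomposition G v (hcomp v).
Proof. by have [c [dc _]] := gG.2 v; apply: xgetI dc. Qed.

Lemma hcomp_unique v c : decomposition G v c -> hcomp v = c.
Proof.
move=> dc; have [e [_ u]] := gG.2 v.
by rewrite -(u _ dc) -(u _ (hcompP v)).
Qed.

Lemma hcomp_linear i : linear (hcomp^~ i).
Proof.
by move=> r u v; rewrite (hcomp_unique (decomposition_lin r gG.1 (hcompP u) (hcompP v))).
Qed.

Lemma hcomp_homog i j v : v \in G j -> hcomp v i = if i == j then v else 0.
Proof. by move=> /(decomposition_homog gG.1)/hcomp_unique ->. Qed.

Lemma hcomp_in i v : hcomp v i \in G i.
Proof. by have [] := hcompP v. Qed.

Lemma homog_ind (P : V -> Prop) : P 0 -> (forall x y, P x -> P y -> P (x + y)) ->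
  (forall i x, x \in G i -> P x) -> forall x, P x.
Proof.
move=> P0 PD PG x; have [cG fc ->] := hcompP x.
rewrite (fsum_seq fc) => [|i /= /negP]; last by rewrite negbK => /eqP.
by elim/big_ind: _ => // i _; apply: PG (cG i).
Qed.

Lemma homog_eq (W : lmodType R) (f g : V -> W) : linear f -> linear g ->
  (forall i x, x \in G i -> f x = g x) -> f =1 g.
Proof.
move=> lf lg fg; apply: homog_ind => //; first by rewrite !linear0'.
by move=> x y; rewrite !linearD' // => -> ->.
Qed.

(* The additive map that sends a homogeneous [v] of degree [i] to [f i v]. *)
Definition hsum (W : lmodType R) (f : int -> V -> W) (v : V) : W :=
  \sum_(i \in [set: int]) f i (hcomp v i).

Lemma hsum_homog (W : lmodType R) (f : int -> V -> W) i v :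
  (forall j, f j 0 = 0) -> v \in G i -> hsum f v = f i v.
Proof.
move=> f0 vi; rewrite /hsum (fsum1 (i := i)) => [|j ji]; rewrite (hcomp_homog _ vi) ?eqxx //.
by rewrite (negPf ji).
Qed.

Lemma hsum_linear (W : lmodType R) (f : int -> V -> W) :
  (forall i, linear (f i)) -> linear (hsum f).
Proof.
move=> lf r u v; have [_ fu _] := hcompP u; have [_ fv _] := hcompP v.
set D := [set i | hcomp u i != 0] `|` [set i | hcomp v i != 0].
have fD : finite_set D by rewrite finite_setU.
have DP i : ~ D i -> hcomp u i = 0 /\ hcomp v i = 0.
  by move/not_orP => /= [/negP + /negP]; rewrite !negbK => /eqP + /eqP.
rewrite /hsum !(fsum_seq fD).
- rewrite scaler_sumr -big_split; apply: eq_bigr => i _.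
  by rewrite hcomp_linear lf.
- by move=> i /DP[_ ->]; rewrite linear0'.
- by move=> i /DP[-> _]; rewrite linear0'.
- by move=> i /DP[u0 v0]; rewrite hcomp_linear u0 v0 scaler0 addr0 linear0'.
Qed.

Lemma hsum_linear_par (U W : lmodType R) (f : int -> U -> V -> W) v :
  (forall i x, linear (f i ^~ x)) -> (forall i u, f i u 0 = 0) ->
  linear (fun u => hsum (fun i => f i u) v).
Proof.
move=> lf f0 r u w; have [_ fv _] := hcompP v.
have DP i : ~ [set i | hcomp v i != 0] i -> hcomp v i = 0.
  by move/negP; rewrite negbK => /eqP.
rewrite /hsum !(fsum_seq fv); try by move=> i /DP ->.
rewrite scaler_sumr -big_split; apply: eq_bigr => i _.
by rewrite lf.
Qed.

End Grading.

Section TensorR.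
Variables (R : comPzRingType) (M N : lmodType R).

Definition bilinear_relations : set (freem R (M * N)%type) :=
  [set t | exists r m m' n,
     t = free_gen R (r *: m + m', n) - (r *: free_gen R (m, n) + free_gen R (m', n))] `|`
  [set t | exists r m n n',
     t = free_gen R (m, r *: n + n') - (r *: free_gen R (m, n) + free_gen R (m, n'))].

Definition tensR : lmodType R := quotm bilinear_relations.

Definition tensR_mk (m : M) (n : N) : tensR := qproj bilinear_relations (free_gen R (m, n)).

Lemma tensR_bilin : bilin tensR_mk.
Proof.
split=> [n r m m'|m r n n'].
- rewrite /tensR_mk -proj_linear; apply/projP/mem_span; left.
  by exists r, m, m', n.
- rewrite /tensR_mk -proj_linear; apply/projP/mem_span; right.
  by exists r, m, n, n'.
Qed.

Lemma tensR_ind (P : tensR -> Prop) : P 0 ->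
  (forall r x y, P x -> P y -> P (r *: x + y)) ->
  (forall m n, P (tensR_mk m n)) -> forall t, P t.
Proof.
move=> P0 PD PM t; have [f ->] := proj_surj t; rewrite (free_span f).
have fN x : ~ [set x | f x != 0] x -> f x = 0.
  by move=> /= /negP; rewrite negbK => /eqP.
rewrite (fsum_seq (finite_supp f)); last by move=> x /fN ->; exact: scale0r.
elim: (fset_set _ : seq _) => [|[m n] s IH].
  by rewrite big_nil linear0' //; apply: proj_linear.
rewrite big_cons.
rewrite (proj_linear bilinear_relations (f (m, n)) (free_gen R (m, n))).
by apply: PD => //; apply: PM.
Qed.

Definition tensR_lift (W : lmodType R) (f : M -> N -> W) : tensR -> W :=
  quot_lift (free_lift (fun p : M * N => f p.1 p.2)).

Section Lift.
Variables (W : lmodType R) (f : M -> N -> W) (bf : bilin f).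

Let free_lift0 s : bilinear_relations s ->
  free_lift (fun p : M * N => f p.1 p.2) s = 0.
Proof.
have lf := @free_lift_linear R (M * N)%type W (fun p => f p.1 p.2).
case=> [[r [m [m' [n ->]]]]|[r [m [n [n' ->]]]]];
  rewrite -scaleN1r addrC lf lf !free_lift_gen /= ?bf.1 ?bf.2;
  by rewrite scaleN1r addNr.
Qed.

Lemma tensR_lift_mk m n : tensR_lift f (tensR_mk m n) = f m n.
Proof.
rewrite /tensR_lift quot_lift_proj ?free_lift_gen //; exact: free_lift_linear.
Qed.

Lemma tensR_lift_linear : linear (tensR_lift f).
Proof. by apply: quot_lift_linear => //; apply: free_lift_linear. Qed.

End Lift.
End TensorR.

Section DG.
Variable R : comPzRingType.

Record complex := Complex {
  csort :> lmodType R;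
  homog : int -> {pred csort};
  homog_grading : is_grading homog;
  cd : csort -> csort;
  cd_linear : linear cd;
  cd_homog : forall i x, x \in homog i -> cd x \in homog (i - 1);
  cd_cd : forall x, cd (cd x) = 0
}.
Arguments homog {c} _.
Arguments cd {c} _.

Section ComplexTheory.
Variable C : complex.

Lemma homog_closed i : submod_closed (@homog C i).
Proof. exact: (homog_grading C).1. Qed.

Lemma homog0 i : (0 : C) \in homog i.
Proof. exact: (homog_closed i).1. Qed.

Lemma homogZ i r (x : C) : x \in homog i -> r *: x \in homog i.
Proof. by move=> xi; rewrite -[_ *: _]addr0 (homog_closed i).2 // homog0. Qed.

Lemma homogD i (x y : C) : x \in homog i -> y \in homog i -> x + y \in homog i.
Proof. by move=> xi yi; rewrite -[x]scale1r (homog_closed i).2. Qed.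

(* [twist x] is [(-1)^|x| x] for homogeneous [x]. *)
Definition twist : C -> C := hsum homog (fun i x => sgn R i *: x).

Lemma scale_linear r : linear (fun x : C => r *: x).
Proof. by move=> s x y; rewrite scalerDr !scalerA mulrC. Qed.

Lemma twist_homog i (x : C) : x \in homog i -> twist x = sgn R i *: x.
Proof. by move=> xi; rewrite /twist (hsum_homog (homog_grading C) _ xi) // => j; rewrite scaler0. Qed.

Lemma twist_linear : linear twist.
Proof. by apply: (hsum_linear (homog_grading C)) => i; apply: scale_linear. Qed.

End ComplexTheory.

(* A dg [R]-algebra structure on a complex; [R]-bilinearity of the product says
   in particular that [C_0 = R] acts through the given [R]-module structure. *)
Record is_dga (C : complex) (one : C) (mul : C -> C -> C) : Prop := IsDGA {
  dga_neg : forall i (x : C), i < 0 -> x \in homog i -> x = 0;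
  dga_bilin : bilin mul;
  dga_mulA : associative mul;
  dga_mul1l : left_id one mul;
  dga_mul1r : right_id one mul;
  dga_one : one \in homog 0;
  (* [C_0 = R]: the structure map [r |-> r *: one] is a bijection [R -> C_0]. *)
  dga_deg0 : forall x : C, x \in homog 0 -> exists! r : R, x = r *: one;
  dga_mul_homog : forall i j (x y : C), x \in homog i -> y \in homog j ->
    mul x y \in homog (i + j);
  dga_leibniz : forall i j (x y : C), x \in homog i -> y \in homog j ->
    cd (mul x y) = mul (cd x) y + sgn R i *: mul x (cd y)
}.

Definition graded_commutative (C : complex) (mul : C -> C -> C) :=
  forall i j (x y : C), x \in homog i -> y \in homog j ->
    mul x y = sgn R (i * j) *: mul y x.

Definition strictly_commutative (C : complex) (mul : C -> C -> C) :=
  graded_commutative mul /\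
  forall i (x : C), x \in homog i -> odd `|i| -> mul x x = 0.

Record dgAlgebra := DGAlgebra {
  dga_complex :> complex;
  aone : dga_complex;
  amul : dga_complex -> dga_complex -> dga_complex;
  dgaP : is_dga aone amul
}.
Arguments amul {d} _ _.

Record cdgAlgebra := CDGAlgebra {
  cdga_algebra :> dgAlgebra;
  amulC : graded_commutative (@amul cdga_algebra)
}.

Record is_dgmodule (A : dgAlgebra) (M : complex) (act : A -> M -> M) : Prop :=
  IsDGModule {
  dgm_bilin : bilin act;
  dgm_actA : forall a b m, act (amul a b) m = act a (act b m);
  dgm_act1 : forall m, act (aone A) m = m;
  dgm_act_homog : forall i j a m, a \in homog i -> m \in homog j ->
    act a m \in homog (i + j);
  dgm_leibniz : forall i j a m, a \in homog i -> m \in homog j ->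
    cd (act a m) = act (cd a) m + sgn R i *: act a (cd m)
}.

Record dgModule (A : dgAlgebra) := DGModule {
  dgm_complex :> complex;
  act : A -> dgm_complex -> dgm_complex;
  dgmP : is_dgmodule act
}.
Arguments act {A d} _ _.

Fact regularP (A : dgAlgebra) : is_dgmodule (@amul A).
Proof. by case: (dgaP A) => *; split. Qed.

Definition regular (A : dgAlgebra) : dgModule A := DGModule (regularP A).

Definition homogeneous_map (M N : complex) (s : int) (f : M -> N) :=
  forall i m, m \in homog i -> f m \in homog (i + s).

Record Alinear (A : dgAlgebra) (M N : dgModule A) (s : int) (f : M -> N) : Prop :=
  ALinear {
  alin_linear : linear f;
  alin_homog : homogeneous_map s f;
  alin_act : forall i j a m, a \in homog i -> m \in homog j ->
    f (act a m) = sgn R (i * s) *: act a (f m)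
}.

Record dgHom (A : dgAlgebra) (M N : dgModule A) := DGHom {
  dgh_map :> M -> N;
  dgh_Alinear : Alinear 0 dgh_map;
  dgh_cd : forall m, dgh_map (cd m) = cd (dgh_map m)
}.

Lemma dgh_linear (A : dgAlgebra) (M N : dgModule A) (f : dgHom M N) : linear f.
Proof. exact: alin_linear (dgh_Alinear f). Qed.

Lemma dgh_homog (A : dgAlgebra) (M N : dgModule A) (f : dgHom M N) :
  homogeneous_map 0 f.
Proof. exact: alin_homog (dgh_Alinear f). Qed.

Section RightAction.
Variables (A : dgAlgebra) (M : dgModule A).

(* [ract m a] is [(-1)^(|a||m|) a m] for homogeneous [m] and [a]. *)
Definition ract (m : M) (a : A) : M :=
  hsum homog (fun i a' =>
    hsum homog (fun j m' => sgn R (i * j) *: act a' m') m) a.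

Lemma actB : bilin (@act A M). Proof. exact: dgm_bilin (dgmP M). Qed.

Lemma act0 (a : A) : act a (0 : M) = 0.
Proof. by rewrite (linear0' (actB.2 a)). Qed.

Lemma act0l (m : M) : act (0 : A) m = 0.
Proof. by rewrite (linear0' (actB.1 m)). Qed.

Lemma ract_bilin : bilin ract.
Proof.
have l1 i j a : linear (fun m : M => sgn R (i * j) *: act a m).
  by move=> r x y; rewrite actB.2 scalerDr !scalerA mulrC.
have l2 i m : linear (fun a => hsum homog (fun j (m' : M) => sgn R (i * j) *: act a m') m).
  apply: (@hsum_linear_par R M homog (homog_grading M) _ _
    (fun j a (m' : M) => sgn R (i * j) *: act a m')) => [j x r a b|j a].
    by rewrite actB.1 scalerDr !scalerA mulrC.
  by rewrite act0 scaler0.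
split=> [a|m].
- apply: (@hsum_linear_par R A homog (homog_grading A) _ _
    (fun i m a' => hsum homog (fun j m' => sgn R (i * j) *: act a' m') m)).
    move=> i x; apply: (hsum_linear (homog_grading M)) => j; exact: l1.
  by move=> i u; rewrite (linear0' (l2 i u)).
- by apply: (hsum_linear (homog_grading A)) => i; apply: l2.
Qed.

Lemma ract_homog i j (a : A) (m : M) : a \in homog i -> m \in homog j ->
  ract m a = sgn R (i * j) *: act a m.
Proof.
move=> ai mj; rewrite /ract (hsum_homog (homog_grading A) _ ai).
  by rewrite (hsum_homog (homog_grading M) _ mj) // => k; rewrite act0 scaler0.
move=> k; rewrite /hsum (fsum1 (i := 0)) ?act0l ?scaler0 // => l _.
by rewrite act0l scaler0.
Qed.

End RightAction.

Section ModuleTheory.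
Variables (A : dgAlgebra) (M : dgModule A).

Lemma homog_eq2 (U V : complex) (W : lmodType R) (f g : U -> V -> W) :
  bilin f -> bilin g ->
  (forall i j u v, u \in homog i -> v \in homog j -> f u v = g u v) ->
  forall u v, f u v = g u v.
Proof.
move=> bf bg fg u v; move: u; apply: (homog_eq (homog_grading U)) => [||i u ui].
- exact: bf.1.
- exact: bg.1.
move: v; apply: (homog_eq (homog_grading V)) => [||j v vj]; [exact: bf.2|exact: bg.2|].
exact: fg ui vj.
Qed.

Lemma sgnZ (V : lmodType R) (i j : int) (v : V) :
  sgn R i *: (sgn R j *: v) = sgn R (i + j) *: v.
Proof. by rewrite scalerA -sgnD. Qed.

Lemma bilinZr (U V W : lmodType R) (f : U -> V -> W) r u v : bilin f ->
  f u (r *: v) = r *: f u v.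
Proof. by move=> bf; rewrite (linearZ' (bf.2 u)). Qed.
Lemma bilinZl (U V W : lmodType R) (f : U -> V -> W) r u v : bilin f ->
  f (r *: u) v = r *: f u v.
Proof. by move=> bf; rewrite (linearZ' (bf.1 v)). Qed.
Lemma bilinDr (U V W : lmodType R) (f : U -> V -> W) u v w : bilin f ->
  f u (v + w) = f u v + f u w.
Proof. by move=> bf; rewrite (linearD' (bf.2 u)). Qed.
Lemma bilinDl (U V W : lmodType R) (f : U -> V -> W) u v w : bilin f ->
  f (v + w) u = f v u + f w u.
Proof. by move=> bf; rewrite (linearD' (bf.1 u)). Qed.

Lemma act_homog i j (a : A) (m : M) : a \in homog i -> m \in homog j ->
  act a m \in homog (i + j).
Proof. exact: (dgm_act_homog (dgmP M)). Qed.

Lemma ract_in i j (a : A) (m : M) : a \in homog i -> m \in homog j ->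
  ract m a \in homog (i + j).
Proof. by move=> ai mj; rewrite (ract_homog ai mj) homogZ ?act_homog. Qed.

Lemma twist_in (C : complex) i (x : C) : x \in homog i -> twist x \in homog i.
Proof. by move=> xi; rewrite (twist_homog xi) homogZ. Qed.

Lemma twist_ract (m : M) (a : A) : twist (ract m a) = ract (twist m) (twist a).
Proof.
apply: (@homog_eq2 M A _ (fun m a => twist (ract m a)) (fun m a => ract (twist m) (twist a))).
- split=> [a'|m'] r x y; first by rewrite (ract_bilin M).1 twist_linear.
  by rewrite (ract_bilin M).2 twist_linear.
- split=> [a'|m'] r x y; first by rewrite twist_linear (ract_bilin M).1.
  by rewrite twist_linear (ract_bilin M).2.
move=> i j u v ui vj.
rewrite (twist_homog (ract_in vj ui)) (twist_homog ui) (twist_homog vj).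
by rewrite (bilinZl _ _ _ (ract_bilin M)) (bilinZr _ _ _ (ract_bilin M)) sgnZ addrC.
Qed.

Lemma twist_act (a : A) (m : M) : twist (act a m) = act (twist a) (twist m).
Proof.
apply: (@homog_eq2 A M _ (fun a m => twist (act a m)) (fun a m => act (twist a) (twist m))).
- split=> [a'|m'] r x y; first by rewrite (actB M).1 twist_linear.
  by rewrite (actB M).2 twist_linear.
- split=> [a'|m'] r x y; first by rewrite twist_linear (actB M).1.
  by rewrite twist_linear (actB M).2.
move=> i j u v ui vj.
rewrite (twist_homog (act_homog ui vj)) (twist_homog ui) (twist_homog vj).
by rewrite (bilinZl _ _ _ (actB M)) (bilinZr _ _ _ (actB M)) sgnZ.
Qed.

Lemma cd_act (a : A) (m : M) : cd (act a m) = act (cd a) m + act (twist a) (cd m).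
Proof.
apply: (@homog_eq2 A M _ (fun a m => cd (act a m))
  (fun a m => act (cd a) m + act (twist a) (cd m))).
- split=> [a'|m'] r x y; first by rewrite (actB M).1 cd_linear.
  by rewrite (actB M).2 cd_linear.
- split=> [a'|m'] r x y.
    by rewrite cd_linear twist_linear !(actB M).1 scalerDr addrACA.
  by rewrite cd_linear !(actB M).2 scalerDr addrACA.
move=> i j u v ui vj.
by rewrite (dgm_leibniz (dgmP M) ui vj) (twist_homog ui) (bilinZl _ _ _ (actB M)).
Qed.

Lemma cd_ract (m : M) (a : A) : cd (ract m a) = ract (cd m) a + ract (twist m) (cd a).
Proof.
apply: (@homog_eq2 M A _ (fun m a => cd (ract m a))
  (fun m a => ract (cd m) a + ract (twist m) (cd a))).
- split=> [a'|m'] r x y; first by rewrite (ract_bilin M).1 cd_linear.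
  by rewrite (ract_bilin M).2 cd_linear.
- split=> [a'|m'] r x y.
    by rewrite cd_linear twist_linear !(ract_bilin M).1 scalerDr addrACA.
  by rewrite cd_linear !(ract_bilin M).2 scalerDr addrACA.
move=> i j u v ui vj; rewrite (ract_homog vj ui) (linearZ' (@cd_linear M)).
rewrite (dgm_leibniz (dgmP M) vj ui) scalerDr (twist_homog ui) sgnZ addrC.
rewrite (bilinZl _ _ _ (ract_bilin M)).
rewrite (ract_homog vj (cd_homog ui)) (ract_homog (cd_homog vj) ui) sgnZ.
congr (_ *: _ + _ *: _).
  by apply: (@sgnE _ _ _ j); ring.
by apply: (@sgnE _ _ _ 0); ring.
Qed.

End ModuleTheory.

Section CommutativeTheory.
Variables (A : cdgAlgebra) (M : dgModule A).

Lemma ract_ract (m : M) (a b : A) : ract (ract m a) b = ract m (amul a b).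
Proof.
have bA := dga_bilin (dgaP A); have bR := ract_bilin M.
move: b; apply: (homog_eq (homog_grading A)) => [r x y|r x y|k b bk].
- by rewrite bR.2.
- by rewrite bA.2 bR.2.
apply: (@homog_eq2 M A _ (fun m a => ract (ract m a) b) (fun m a => ract m (amul a b))).
- by split=> [a'|m'] r x y; [rewrite !bR.1|rewrite bR.2 bR.1].
- by split=> [a'|m'] r x y; [rewrite !bR.1|rewrite bA.1 bR.2].
move=> i j {}m {}a mi aj.
rewrite (ract_homog bk (ract_in aj mi)) (ract_homog aj mi).
rewrite (ract_homog (dga_mul_homog (dgaP A) aj bk) mi) (amulC aj bk).
rewrite (bilinZl _ _ _ (actB M)).
rewrite (bilinZr _ _ _ (actB M)).
rewrite (dgm_actA (dgmP M)) !sgnZ; congr (_ *: _).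
by apply: (@sgnE _ _ _ 0); ring.
Qed.

Lemma act_ract (m : M) (a b : A) : act a (ract m b) = ract (act a m) b.
Proof.
have bA := actB M; have bR := ract_bilin M.
move: b; apply: (homog_eq (homog_grading A)) => [r x y|r x y|k b bk].
- by rewrite bR.2 bA.2.
- by rewrite bR.2.
apply: (@homog_eq2 M A _ (fun m a => act a (ract m b)) (fun m a => ract (act a m) b)).
- by split=> [a'|m'] r x y; [rewrite bR.1 bA.2|rewrite bA.1].
- by split=> [a'|m'] r x y; [rewrite bA.2 bR.1|rewrite bA.1 bR.1].
move=> i j {}m {}a mi aj.
rewrite (ract_homog bk mi) (ract_homog bk (act_homog aj mi)).
rewrite (bilinZr _ _ _ (actB M)).
rewrite -!(dgm_actA (dgmP M)) (amulC aj bk) (bilinZl _ _ _ (actB M)).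
rewrite sgnZ; congr (_ *: _).
by apply: (@sgnE _ _ _ 0); ring.
Qed.

Lemma regular_ract (a b : A) : ract (a : regular A) b = amul a b.
Proof.
apply: (@homog_eq2 A A _ (fun a b => ract (a : regular A) b) (fun a b => amul a b)).
- exact: (ract_bilin (regular A)).
- exact: dga_bilin (dgaP A).
move=> i j {}a {}b ai bj; rewrite (@ract_homog A (regular A) j i b a bj ai).
by rewrite (amulC ai bj) mulrC.
Qed.

End CommutativeTheory.

Lemma linear_comb (U V : lmodType R) (f g : U -> V) r : linear f -> linear g ->
  linear (fun x => r *: f x + g x).
Proof.
move=> lf lg s x y; rewrite lf lg !scalerDr addrACA.
by congr (_ + _ + _); rewrite !scalerA mulrC.
Qed.

(* [M \otimes_A N], as the quotient of [M \otimes_R N] by the submodule generated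
   by the elements [ma \otimes n - m \otimes an]. *)
Section Tensor.
Variables (A : cdgAlgebra) (M N : dgModule A).

Definition balanced_relations : set (tensR M N) :=
  [set t | exists m a n, t = tensR_mk (ract m a) n - tensR_mk m (act a n)].

Definition tens : lmodType R := quotm balanced_relations.

Definition tmk (m : M) (n : N) : tens := qproj balanced_relations (tensR_mk m n).

Lemma tmk_bilin : bilin tmk.
Proof.
by split=> [n|m] r x y; rewrite /tmk ?(tensR_bilin M N).1 ?(tensR_bilin M N).2 proj_linear.
Qed.

Lemma tmk_balanced m a n : tmk (ract m a) n = tmk m (act a n).
Proof. by apply/projP/mem_span; exists m, a, n. Qed.

Lemma tens_ind (P : tens -> Prop) : P 0 ->
  (forall r x y, P x -> P y -> P (r *: x + y)) ->
  (forall m n, P (tmk m n)) -> forall t, P t.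
Proof.
move=> P0 PD PM t; have [f ->] := proj_surj t.
elim/tensR_ind: f => [|r x y Px Py|m n]; last exact: PM.
  by rewrite linear0' //; apply: proj_linear.
by rewrite proj_linear; apply: PD.
Qed.

Lemma tens_eq (W : lmodType R) (f g : tens -> W) : linear f -> linear g ->
  (forall m n, f (tmk m n) = g (tmk m n)) -> f =1 g.
Proof.
move=> lf lg fg; apply: tens_ind => [|r x y fx fy|//]; first by rewrite !linear0'.
by rewrite lf lg fx fy.
Qed.

Definition balanced (W : lmodType R) (f : M -> N -> W) :=
  forall m a n, f (ract m a) n = f m (act a n).

Definition tens_lift (W : lmodType R) (f : M -> N -> W) : tens -> W :=
  quot_lift (tensR_lift f).

Section Lift.
Variables (W : lmodType R) (f : M -> N -> W) (bf : bilin f) (baf : balanced f).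

Let lift0 s : balanced_relations s -> tensR_lift f s = 0.
Proof.
case=> m [a [n ->]]; rewrite -scaleN1r addrC tensR_lift_linear //.
by rewrite !tensR_lift_mk // baf scaleN1r addNr.
Qed.

Lemma tens_lift_mk m n : tens_lift f (tmk m n) = f m n.
Proof.
rewrite /tens_lift quot_lift_proj ?tensR_lift_mk //; exact: tensR_lift_linear.
Qed.

Lemma tens_lift_linear : linear (tens_lift f).
Proof. by apply: quot_lift_linear => //; apply: tensR_lift_linear. Qed.

End Lift.

Definition tens_cd : tens -> tens :=
  tens_lift (fun m n => tmk (cd m) n + tmk (twist m) (cd n)).

Fact tens_cd_bilin : bilin (fun m n => tmk (cd m) n + tmk (twist m) (cd n)).
Proof.
split=> [n|m] r x y.
  by rewrite cd_linear twist_linear !tmk_bilin.1 scalerDr addrACA.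
by rewrite cd_linear !tmk_bilin.2 scalerDr addrACA.
Qed.

Fact tens_cd_balanced : balanced (fun m n => tmk (cd m) n + tmk (twist m) (cd n)).
Proof.
move=> m a n; rewrite cd_ract cd_act twist_ract.
rewrite (bilinDl _ _ _ tmk_bilin) (bilinDr _ _ _ tmk_bilin).
rewrite (tmk_balanced (cd m)) (tmk_balanced (twist m) (cd a)).
by rewrite (tmk_balanced (twist m) (twist a)) addrA.
Qed.

Lemma tens_cdE m n : tens_cd (tmk m n) = tmk (cd m) n + tmk (twist m) (cd n).
Proof. exact: (tens_lift_mk tens_cd_bilin tens_cd_balanced). Qed.

Lemma tens_cd_linear : linear tens_cd.
Proof. exact: (tens_lift_linear tens_cd_bilin tens_cd_balanced). Qed.

Lemma tens_cd_homog i m n : m \in homog i ->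
  tens_cd (tmk m n) = tmk (cd m) n + sgn R i *: tmk m (cd n).
Proof.
by move=> mi; rewrite tens_cdE (twist_homog mi) (bilinZl _ _ _ tmk_bilin).
Qed.

(* The left action; [tens_ract] below checks that the associated right action is
   [(m \otimes n) a = m \otimes (n a)]. *)
Definition tens_act (a : A) : tens -> tens := tens_lift (fun m n => tmk (act a m) n).

Fact tens_act_bilin a : bilin (fun m n => tmk (act a m) n).
Proof.
by split=> [n|m] r x y; [rewrite (actB M).2 tmk_bilin.1|rewrite tmk_bilin.2].
Qed.

Fact tens_act_balanced a : balanced (fun m n => tmk (act a m) n).
Proof. by move=> m b n; rewrite act_ract tmk_balanced. Qed.

Lemma tens_actE a m n : tens_act a (tmk m n) = tmk (act a m) n.
Proof. exact: (tens_lift_mk (tens_act_bilin a) (tens_act_balanced a)). Qed.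

Lemma tens_act_linear a : linear (tens_act a).
Proof. exact: (tens_lift_linear (tens_act_bilin a) (tens_act_balanced a)). Qed.

Definition tens_homog (k : int) : {pred tens} :=
  gspan [set t | exists i j m n,
    [/\ m \in homog i, n \in homog j, i + j = k & t = tmk m n]].

Let pf k (m : M) (n : N) : tens :=
  hsum homog (fun i m' => tmk m' (hcomp homog n (k - i))) m.

Let pf_bilin k : bilin (pf k).
Proof.
split=> [n|m].
- by apply: (hsum_linear (homog_grading M)) => i; apply: tmk_bilin.1.
apply: (@hsum_linear_par R M homog (homog_grading M) _ _
  (fun i n m' => tmk m' (hcomp homog n (k - i)))) => [i x r n n'|i n].
  by rewrite (hcomp_linear (homog_grading N)) tmk_bilin.2.
by rewrite (linear0' (tmk_bilin.1 _)).
Qed.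

Let pf_homog k i j m n : m \in homog i -> n \in homog j ->
  pf k m n = if k == i + j then tmk m n else 0.
Proof.
move=> mi nj; rewrite /pf (hsum_homog (homog_grading M) _ mi).
  rewrite (hcomp_homog (homog_grading N) _ nj) subr_eq addrC.
  by case: eqP => // _; rewrite (linear0' (tmk_bilin.2 _)).
by move=> l; rewrite (linear0' (tmk_bilin.1 _)).
Qed.

Let pf_balanced k : balanced (pf k).
Proof.
move=> m a n; have bR := ract_bilin M; have bA := actB N; have bp := pf_bilin k.
move: n; apply: (homog_eq (homog_grading N)) => [|r x y|l n nl].
- exact: bp.2.
- by rewrite bA.2 bp.2.
apply: (@homog_eq2 M A _ (fun m a => pf k (ract m a) n) (fun m a => pf k m (act a n))).
- by split=> [a'|m'] r x y; [rewrite bR.1 bp.1|rewrite bR.2 bp.1].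
- by split=> [a'|m'] r x y; [rewrite bp.1|rewrite bA.1 bp.2].
move=> i j {}m {}a mi aj.
rewrite (pf_homog k (ract_in aj mi) nl) (pf_homog k mi (act_homog aj nl)).
by rewrite tmk_balanced addrCA addrA.
Qed.

Lemma tens_grading : is_grading tens_homog.
Proof.
apply: (@grading_of_proj R tens tens_homog (fun k => tens_lift (pf k))).
- by move=> k; apply: span_submod_closed.
- by move=> k; apply: tens_lift_linear.
- move=> k l t; elim/span_ind: t / => [|r x y hx hy|t [i [j [m [n [mi nj ij ->]]]]]].
  + by rewrite linear0'; [case: eqP|exact: tens_lift_linear].
  + rewrite tens_lift_linear // hx hy; case: eqP => //.
    by rewrite scaler0 addr0.
  + by rewrite tens_lift_mk // (pf_homog k mi nj) ij.
set S := [set _ | _].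
have sS i j m n : m \in homog i -> n \in homog j -> tmk m n \in gspan S.
  move=> mi nj; apply: mem_span; exists (i + j); apply: mem_span.
  by exists i, j, m, n.
have [S0 SD] : submod_closed (gspan S) by apply: span_submod_closed.
have SD1 x y : x \in gspan S -> y \in gspan S -> x + y \in gspan S.
  by move=> xS yS; rewrite -[x]scale1r SD.
elim/tens_ind => [|r x y|m n] //; first exact: SD.
elim/(homog_ind (homog_grading M)): m => [|x y|i m mi].
- by rewrite (linear0' (tmk_bilin.1 _)).
- by rewrite (linearD' (tmk_bilin.1 _)); exact: SD1.
elim/(homog_ind (homog_grading N)): n => [|x y|j n nj].
- by rewrite (linear0' (tmk_bilin.2 _)).
- by rewrite (linearD' (tmk_bilin.2 _)); exact: SD1.
exact: sS mi nj.
Qed.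

Lemma tmk_homog i j m n : m \in homog i -> n \in homog j ->
  tmk m n \in tens_homog (i + j).
Proof. by move=> mi nj; apply: mem_span; exists i, j, m, n. Qed.

Fact tens_cd_deg k t : t \in tens_homog k -> tens_cd t \in tens_homog (k - 1).
Proof.
have [S0 SD] : submod_closed (tens_homog (k - 1)) by apply: span_submod_closed.
elim/span_ind: t / => [|r x y hx hy|t [i [j [m [n [mi nj ij ->]]]]]].
- by rewrite linear0' //; exact: tens_cd_linear.
- by rewrite (tens_cd_linear r x y); apply: SD hx hy.
rewrite tens_cdE -[tmk (cd m) n]scale1r; apply: SD; rewrite -ij.
  by rewrite addrAC; apply: tmk_homog (cd_homog mi) nj.
by rewrite -addrA; apply: tmk_homog (twist_in mi) (cd_homog nj).
Qed.

Fact tens_cd_cd t : tens_cd (tens_cd t) = 0.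
Proof.
move: t; apply: tens_eq => [||m n].
- exact: linear_comp' tens_cd_linear tens_cd_linear.
- exact: linear_cst0.
rewrite tens_cdE (linearD' tens_cd_linear) !tens_cdE !cd_cd.
rewrite (linear0' (tmk_bilin.1 _)) (linear0' (tmk_bilin.2 _)) addr0 add0r.
rewrite -(bilinDl _ _ _ tmk_bilin).
suff -> : twist (cd m) + cd (twist m) = 0 by rewrite (linear0' (tmk_bilin.1 _)).
apply: (@homog_eq R M homog (homog_grading M) _ (fun m => twist (cd m) + cd (twist m)) (fun=> 0)).
- move=> r x y; rewrite cd_linear !twist_linear cd_linear scalerDr.
  exact: addrACA.
- by move=> r x y; rewrite scaler0 addr0.
move=> i x xi; rewrite (twist_homog xi) (twist_homog (cd_homog xi)).
rewrite (linearZ' (@cd_linear M)) sgnD /sgn /= expr1 mulrN1.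
by rewrite scaleNr addNr.
Qed.

Definition tens_complex : complex :=
  Complex tens_grading tens_cd_linear tens_cd_deg tens_cd_cd.

Lemma tens_actB : bilin tens_act.
Proof.
split=> [t r a b|a]; last exact: tens_act_linear.
move: t; apply: tens_eq => [||m n]; first exact: tens_act_linear.
- exact: linear_comb _ (tens_act_linear a) (tens_act_linear b).
- by rewrite !tens_actE (actB M).1 tmk_bilin.1.
Qed.

Lemma tens_act_act a b t : tens_act (amul a b) t = tens_act a (tens_act b t).
Proof.
move: t; apply: tens_eq => [|r x y|m n]; first exact: tens_act_linear.
- by rewrite (tens_act_linear b r x y) (tens_act_linear a r (tens_act b x) (tens_act b y)).
- by rewrite !tens_actE (dgm_actA (dgmP M)).
Qed.

Lemma tens_act1 t : tens_act (aone A) t = t.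
Proof.
move: t; apply: tens_eq => [|r x y|m n]; [exact: tens_act_linear|by []|].
by rewrite tens_actE (dgm_act1 (dgmP M)).
Qed.

Lemma tens_act_homog i k (a : A) t : a \in homog i -> t \in tens_homog k ->
  tens_act a t \in tens_homog (i + k).
Proof.
move=> ai; have [S0 SD] : submod_closed (tens_homog (i + k)) by apply: span_submod_closed.
elim/span_ind: t / => [|r x y hx hy|t [j [l [m [n [mj nl jl ->]]]]]].
- by rewrite linear0' //; exact: tens_act_linear.
- by rewrite (tens_act_linear a r x y); apply: SD hx hy.
by rewrite tens_actE -jl addrA; apply: tmk_homog nl; exact: act_homog.
Qed.

Lemma tens_cd_act i (a : A) t : a \in homog i ->
  tens_cd (tens_act a t) = tens_act (cd a) t + sgn R i *: tens_act a (tens_cd t).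
Proof.
move=> ai; move: t; apply: tens_eq => [r x y||m n].
- by rewrite (tens_act_linear a r x y) (tens_cd_linear r (tens_act a x)).
- under [fun _ => _]funext do rewrite addrC.
  apply: linear_comb _ (tens_act_linear (cd a)) => s u v.
  by rewrite (tens_cd_linear s u v) (tens_act_linear a s (tens_cd u)).
rewrite tens_actE !tens_cdE tens_actE.
rewrite (linearD' (tens_act_linear a)) !tens_actE cd_act twist_act (twist_homog ai).
rewrite !(bilinZl _ _ _ (actB M)) (bilinDl _ _ _ tmk_bilin).
by rewrite !(bilinZl _ _ _ tmk_bilin) scalerDr addrA.
Qed.

Fact tensorP : @is_dgmodule A tens_complex tens_act.
Proof.
split=> [|a b t|t|i j a t|i j a t ai _].
- exact: tens_actB.
- exact: tens_act_act.
- exact: tens_act1.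
- exact: tens_act_homog.
- exact: tens_cd_act.
Qed.

Definition tensor : dgModule A := DGModule tensorP.

Lemma tens_ract m n (a : A) : ract (tmk m n : tensor) a = tmk m (ract n a).
Proof.
have bR := ract_bilin N; have bT := ract_bilin tensor.
move: n; apply: (homog_eq (homog_grading N)) => [r x y|r x y|j n nj].
- by rewrite tmk_bilin.2 bT.1.
- by rewrite bR.1 tmk_bilin.2.
apply: (@homog_eq2 M A _ (fun m a => ract (tmk m n : tensor) a) (fun m a => tmk m (ract n a))).
- by split=> [a'|m'] r x y; [rewrite tmk_bilin.1 bT.1|rewrite bT.2].
- by split=> [a'|m'] r x y; [rewrite tmk_bilin.1|rewrite bR.2 tmk_bilin.2].
move=> i k {}m {}a mi ak; have mn : (tmk m n : tensor) \in homog (i + j) := tmk_homog mi nj.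
rewrite (ract_homog ak mn) (ract_homog ak nj) /= tens_actE.
rewrite (bilinZr _ _ _ tmk_bilin) -tmk_balanced (ract_homog ak mi).
by rewrite (bilinZl _ _ _ tmk_bilin) sgnZ mulrDr addrC.
Qed.

End Tensor.

Section Theta.
Variables (A : cdgAlgebra) (M : dgModule A) (beta : dgHom M (regular A)).

Definition theta : tensor M M -> M :=
  tens_lift (fun m n => ract m (beta n) - act (beta m) n).

Let theta_bilin : bilin (fun m n : M => ract m (beta n) - act (beta m) n).
Proof.
split=> [n|m] r x y; rewrite dgh_linear.
- by rewrite (ract_bilin M).1 (actB M).1 opprD scalerDr scalerN addrACA.
- by rewrite (ract_bilin M).2 (actB M).2 opprD scalerDr scalerN addrACA.
Qed.

Lemma dgh_act (a : A) (m : M) : beta (act a m) = amul a (beta m).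
Proof.
apply: (@homog_eq2 A M _ (fun a m => beta (act a m)) (fun a m => amul a (beta m))).
- by split=> [x|x] r y z; rewrite ?(actB M).1 ?(actB M).2 dgh_linear.
- have bA := dga_bilin (dgaP A).
  by split=> [x|x] r y z; [rewrite bA.1|rewrite dgh_linear bA.2].
by move=> i j {}a {}m ai mj; rewrite (alin_act (dgh_Alinear beta) ai mj) mulr0 scale1r.
Qed.

Lemma dgh_ract (m : M) (a : A) : beta (ract m a) = amul (beta m) a.
Proof.
rewrite -(regular_ract (beta m) a).
apply: (@homog_eq2 M A _ (fun m a => beta (ract m a)) (fun m a => ract (beta m) a)).
- by split=> [x|x] r y z; rewrite ?(ract_bilin M).1 ?(ract_bilin M).2 dgh_linear.
- by split=> [x|x] r y z; rewrite ?dgh_linear ?(ract_bilin (regular A)).1 ?(ract_bilin (regular A)).2.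
move=> i j {}m {}a mi aj; have bi := dgh_homog beta mi; rewrite addr0 in bi.
rewrite (ract_homog aj mi) (ract_homog aj bi) (linearZ' (dgh_linear beta)).
by rewrite dgh_act.
Qed.

Let theta_balanced : balanced (fun m n : M => ract m (beta n) - act (beta m) n).
Proof.
by move=> m a n; rewrite ract_ract dgh_act dgh_ract (dgm_actA (dgmP M)).
Qed.

Lemma thetaE m n : theta (tmk m n) = ract m (beta n) - act (beta m) n.
Proof. exact: (tens_lift_mk theta_bilin theta_balanced). Qed.

Lemma theta_linear : linear theta.
Proof. exact: (tens_lift_linear theta_bilin theta_balanced). Qed.

End Theta.

Section Cone.
Variables (A : dgAlgebra) (M N : dgModule A) (beta : dgHom M N).

Definition cone_homog (i : int) : {pred (N * M)%type} :=
  fun x => (x.1 \in homog i) && (x.2 \in homog (i - 1)).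

Definition cone_cd (x : N * M) : N * M := (cd x.1 + beta x.2, - cd x.2).

Let cone_closed i : submod_closed (cone_homog i).
Proof.
have [M0 MD] := @homog_closed M (i - 1); have [N0 ND] := @homog_closed N i.
split; first by apply/andP.
by move=> r x y /andP[x1 x2] /andP[y1 y2]; apply/andP; split; [apply: ND|apply: MD].
Qed.

Lemma cone_grading : is_grading cone_homog.
Proof.
have lM := hcomp_linear (homog_grading M); have lN := hcomp_linear (homog_grading N).
apply: (grading_of_proj (p := fun i x => (hcomp homog x.1 i, hcomp homog x.2 (i - 1)))).
- exact: cone_closed.
- by move=> i r x y; rewrite /= lM lN.
- move=> i j [a m] /andP[/= aj mj].
  rewrite (hcomp_homog (homog_grading N) _ aj) (hcomp_homog (homog_grading M) _ mj).
  by rewrite (inj_eq (addIr _)); case: eqP.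
move=> [a m]; set S := [set _ | _].
have [S0 SD] : submod_closed (gspan S) by apply: span_submod_closed.
have SD1 x y : x \in gspan S -> y \in gspan S -> x + y \in gspan S.
  by move=> xS yS; rewrite -[x]scale1r SD.
have -> : (a, m) = (a, 0) + (0, m) by rewrite [RHS]/GRing.add /= /add_pair /= addr0 add0r.
apply: (SD1).
- elim/(homog_ind (homog_grading N)): a => [|x y hx hy|i x xi]; first exact: S0.
    have -> : (x + y, 0 : M) = (x, 0) + (y, 0) by congr pair; rewrite addr0.
    exact: SD1.
  by apply: mem_span; exists i; apply/andP; split=> //=; exact: homog0.
- elim/(homog_ind (homog_grading M)): m => [|x y hx hy|i x xi]; first exact: S0.
    have -> : (0 : N, x + y) = (0, x) + (0, y) by congr pair; rewrite addr0.
    exact: SD1.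
  apply: mem_span; exists (i + 1); apply/andP; rewrite /= addrK.
  by split=> //; exact: homog0.
Qed.

Fact cone_cd_linear : linear cone_cd.
Proof.
move=> r x y; rewrite /cone_cd /= !cd_linear dgh_linear.
congr pair => /=; last by rewrite opprD scalerN.
by rewrite scalerDr addrACA.
Qed.

Fact cone_cd_homog i x : x \in cone_homog i -> cone_cd x \in cone_homog (i - 1).
Proof.
move=> /andP[x1 x2]; apply/andP; split=> /=.
  by rewrite homogD ?cd_homog //; have := dgh_homog beta x2; rewrite addr0.
by rewrite -scaleN1r homogZ ?cd_homog.
Qed.

Fact cone_cd_cd x : cone_cd (cone_cd x) = 0.
Proof.
rewrite /cone_cd /= (linearN' (dgh_linear beta)) (linearN' (@cd_linear M)).
by rewrite (linearD' (@cd_linear N)) !cd_cd dgh_cd add0r subrr !oppr0.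
Qed.

Definition cone : complex :=
  Complex cone_grading cone_cd_linear cone_cd_homog cone_cd_cd.

End Cone.
End DG.

Arguments homog {R c} _.
Arguments cd {R c} _.
Arguments amul {R d} _ _.
Arguments act {R A d} _ _.
Arguments aone {R} d.

Notation "m \ox n" := (tmk m n) (at level 40, left associativity).

(* Main.v *)
Require Import Defs.
From mathcomp Require Import all_boot all_order all_algebra.
From mathcomp Require Import zify ring.

Set Implicit Arguments.
Unset Strict Implicit.
Unset Printing Implicit Defensive.

Import Order.TTheory GRing.Theory Num.Theory.
Local Open Scope ring_scope.

(* Writing the product with the twist map [x |-> (-1)^|x| x] makes it R-bilinear
   on all of the cone and covers the degree-0 products too.  Each algebra axiom
   is then multilinear, so it suffices to compare both sides on homogeneous
   elements, where they agree term by term up to the parity of the sign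
   exponents. *)

(** * Signs that depend only on the parity of their exponent *)

Section SignParity.
Variables (R : pzRingType) (V : lmodType R).

Lemma eq_sgnZ i j (u v : V) :
  odd `|i| = odd `|j| -> u = v -> sgn R i *: u = sgn R j *: v.
Proof. by rewrite /sgn -signr_odd => -> ->; rewrite signr_odd. Qed.

Lemma eq_sgnZN i j (u v : V) :
  odd `|i| = ~~ odd `|j| -> u = v -> sgn R i *: u = - (sgn R j *: v).
Proof.
by rewrite /sgn -signr_odd -(signr_odd _ `|j|) => -> ->; rewrite signrN scaleNr.
Qed.

Lemma sgnZ_even i (v : V) : ~~ odd `|i| -> sgn R i *: v = v.
Proof. by rewrite /sgn -signr_odd => /negPf ->; rewrite scale1r. Qed.

Lemma sgnZ_odd i (v : V) : odd `|i| -> sgn R i *: v = - v.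
Proof. by rewrite /sgn -signr_odd => ->; rewrite scaleN1r. Qed.

End SignParity.

Lemma odd_absD (i j : int) : odd `|i + j| = odd `|i| (+) odd `|j|.
Proof. lia. Qed.

Lemma odd_absM (i j : int) : odd `|i * j| = odd `|i| && odd `|j|.
Proof. by rewrite abszM oddM. Qed.

(** A comparison of sign exponents becomes a family of closed Boolean equations, one for each choice
    of parities of the degrees involved. *)
Ltac parity :=
  rewrite ?(odd_absD, odd_absM, abszN) /=;
  repeat match goal with |- context [odd ?x] => case: (odd x) end.

(** * The product on the cone, and how [mu] interacts with degrees and the two actions *)

Section ConeProduct.
Variables (R : comPzRingType) (A : cdgAlgebra R) (M : dgModule A).
Variables (beta : dgHom M (regular A)) (mu : tensor M M -> M).

Definition cone_mul (x y : cone beta) : cone beta :=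
  (amul x.1 y.1,
   ract x.2 y.1 + act (twist x.1) y.2 + mu (twist x.2 \ox y.2)).

Hypothesis mu_Alinear : Alinear 1 mu.

Let bA := dga_bilin (dgaP A).
Let bact := actB M.
Let bR := ract_bilin M.
Let lbeta := dgh_linear beta.

Lemma mu_tmk_bilin : bilin (fun m n : M => mu (m \ox n)).
Proof.
have bT := tmk_bilin M M.
by split=> [n|m] r x y; rewrite ?bT.1 ?bT.2 (alin_linear mu_Alinear).
Qed.
Let bmu := mu_tmk_bilin.

Lemma mu_tmk_homog i j (m n : M) : m \in homog i -> n \in homog j ->
  mu (m \ox n) \in homog (i + j + 1).
Proof.
by move=> mi nj; apply: (alin_homog mu_Alinear); exact: (tmk_homog mi nj).
Qed.

Lemma mu_act_tmk i j k (a : A) (m n : M) : a \in homog i -> m \in homog j ->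
  n \in homog k -> mu (act a m \ox n) = sgn R i *: act a (mu (m \ox n)).
Proof.
move=> ai mj nk.
have := alin_act mu_Alinear ai (tmk_homog mj nk).
by rewrite mulr1 /= tens_actE.
Qed.

(** In terms of right actions [A]-linearity carries no sign: the factor $(-1)^{|a|}$ from moving [a]
    past the degree-1 map [mu] is absorbed by [ract], since [mu (m \ox n)] has degree one more than
    [m \ox n]. *)
Lemma mu_tmk_ract i j k (a : A) (m n : M) : a \in homog i -> m \in homog j ->
  n \in homog k -> mu (m \ox ract n a) = ract (mu (m \ox n)) a.
Proof.
move=> ai mj nk; rewrite -tens_ract (ract_homog (M := tensor M M) ai (tmk_homog mj nk)).
rewrite (linearZ' (alin_linear mu_Alinear)) (alin_act mu_Alinear ai (tmk_homog mj nk)).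
rewrite (ract_homog ai (mu_tmk_homog mj nk)) sgnZ; apply: eq_sgnZ => //.
by parity.
Qed.

(** Both twists fall on the left factor, so homogeneity of that factor alone turns them into
    explicit signs. *)
Lemma cone_mul_homogE i (a b : A) (m n : M) : a \in homog i -> m \in homog (i - 1) ->
  cone_mul (a, m) (b, n) =
    (amul a b, ract m b + sgn R i *: act a n + sgn R (i - 1) *: mu (m \ox n)).
Proof.
move=> ai mi; rewrite /cone_mul /= (twist_homog ai) (twist_homog mi).
by rewrite (bilinZl _ _ _ bact) (bilinZl _ _ _ bmu).
Qed.

(** * Algebra laws of the cone product *)

Lemma cone_mul_bilin : bilin cone_mul.
Proof.
split=> [y|x] r u v; rewrite /cone_mul; congr pair => /=.
- by rewrite bA.1.
- rewrite bR.1 !twist_linear bact.1 bmu.1.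
  by rewrite (addrACA (r *: _)) (addrACA (_ + _)) !scalerDr.
- by rewrite bA.2.
- rewrite bR.2 bact.2 bmu.2.
  by rewrite (addrACA (r *: _)) (addrACA (_ + _)) !scalerDr.
Qed.

Lemma cone_mul_homog i j (x y : cone beta) : x \in homog i -> y \in homog j ->
  cone_mul x y \in homog (i + j).
Proof.
case: x y => [a m] [b n] /andP[/= ai mi] /andP[/= bj nj].
rewrite (cone_mul_homogE _ _ ai mi); apply/andP; split => /=.
  exact: dga_mul_homog (dgaP A) _ _ _ _ ai bj.
apply: homogD; first apply: homogD.
- by rewrite (addrC i) -addrA; exact: ract_in bj mi.
- by rewrite -addrA; exact/homogZ/(act_homog ai nj).
(* [M] is shifted by one in the cone, so two shifts occur here; the degree 1 of [mu] makes up for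
   one of them. *)
rewrite (_ : i + j - 1 = i - 1 + (j - 1) + 1); last by ring.
exact/homogZ/(mu_tmk_homog mi nj).
Qed.

Lemma cone_mulA :
  (forall (i j k : int) (m n u : M),
      m \in homog i -> n \in homog j -> u \in homog k ->
      mu (mu (m \ox n) \ox u) = - (sgn R i *: mu (m \ox mu (n \ox u)))) ->
  associative cone_mul.
Proof.
move=> mu_assoc x y z; have bC := cone_mul_bilin.
move: z; apply: (homog_eq (homog_grading (cone beta))) => [r u v|r u v|k z zk].
- by rewrite !bC.2.
- by rewrite bC.2.
apply: (@homog_eq2 R (cone beta) (cone beta) _
  (fun x y => cone_mul x (cone_mul y z)) (fun x y => cone_mul (cone_mul x y) z)).
- by split=> [u|u] r v w; rewrite !(bC.1, bC.2).
- by split=> [u|u] r v w; rewrite !(bC.1, bC.2).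
(* The degree of the product [x y] is recorded because it becomes the left factor of the outer
   product, which is then expanded by [cone_mul_homogE] as well. *)
move=> i j {}x {}y xi yj; have xyij := cone_mul_homog xi yj.
case: x y z xi yj zk xyij => [a m] [b n] [c u].
move=> /andP[/= ai mi] /andP[/= bj nj] /andP[/= ck uk].
rewrite (cone_mul_homogE b n ai mi) => /andP[/= abij mnij].
rewrite (cone_mul_homogE _ _ abij mnij) (cone_mul_homogE _ _ bj nj) (cone_mul_homogE _ _ ai mi).
congr pair; first by rewrite (dga_mulA (dgaP A)).
rewrite !(bilinDl _ _ _ bR, bilinDr _ _ _ bact, bilinDl _ _ _ bmu, bilinDr _ _ _ bmu).
rewrite !(bilinZl _ _ _ bR, bilinZr _ _ _ bact, bilinZl _ _ _ bmu, bilinZr _ _ _ bmu).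
rewrite (mu_act_tmk ai nj uk) (mu_tmk_ract ck mi nj) (mu_assoc _ _ _ _ _ _ mi nj uk).
rewrite (tmk_balanced m b u) ract_ract act_ract (dgm_actA (dgmP M)).
(* Each [M]-component has seven terms. After reordering, the first four agree as they stand; those
   in [mu (m \ox act b u)], [act a (mu (n \ox u))] and the iterated [mu] remain to be compared by
   parity. *)
rewrite !scalerDr !scalerN !sgnZ [LHS](AC (1*3*3) (1*2*5*3*(6*4*7))).
congr (_ + (_ + _ + _)).
- by apply: eq_sgnZ => //; parity.
- by apply: eq_sgnZ => //; parity.
- by apply: eq_sgnZN => //; parity.
Qed.

Lemma cone_mulC :
  (forall (i j : int) (m n : M), m \in homog i -> n \in homog j ->
     mu (m \ox n) = - (sgn R (i * j) *: mu (n \ox m))) ->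
  graded_commutative cone_mul.
Proof.
move=> muC i j [a m] [b n] /andP[/= ai mi] /andP[/= bj nj].
rewrite (cone_mul_homogE _ _ ai mi) (cone_mul_homogE _ _ bj nj).
congr pair => /=; first exact: amulC ai bj.
rewrite (ract_homog bj mi) (ract_homog ai nj) (muC _ _ _ _ mi nj).
(* Swapping the factors exchanges the two action terms, hence the transposition of the first two
   summands. *)
rewrite !scalerDr scalerN !sgnZ [LHS](AC 3 (2*1*3)).
congr (_ + _ + _).
- by apply: eq_sgnZ => //; parity.
- by apply: eq_sgnZ => //; parity.
- by apply/esym/eq_sgnZN => //; parity.
Qed.

(** When $|a|$ is odd, $|m|=|a|-1$ is even. Thus $\mu(m\otimes m)=0$, and $ma=am$ cancels against
    $(-1)^{|a|}am=-am$. *)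
Lemma cone_mul_sqr_odd :
  (forall i (a : A), a \in homog i -> odd `|i| -> amul a a = 0) ->
  (forall (i : int) (m : M), m \in homog i -> ~~ odd `|i| -> mu (m \ox m) = 0) ->
  forall i (x : cone beta), x \in homog i -> odd `|i| -> cone_mul x x = 0.
Proof.
move=> sqrA sqrM i [a m] /andP[/= ai mi] oi; rewrite (cone_mul_homogE _ _ ai mi).
have ei : ~~ odd `|i - 1| by move: oi; parity.
rewrite (sqrA i) // (sqrM (i - 1)) // scaler0 addr0 (ract_homog ai mi).
by rewrite sgnZ_even ?sgnZ_odd ?subrr // odd_absM (negPf ei) andbF.
Qed.

(** General [r] gives the action of $C_0=R$; the unit laws are the case [r = 1]. *)
Lemma cone_mul_one (r : R) (x : cone beta) :
  cone_mul (r *: aone A, 0) x = r *: x /\ cone_mul x (r *: aone A, 0) = r *: x.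
Proof.
have dA := dgaP A; have b0 := dga_one dA.
have t1 : twist (r *: aone A) = r *: aone A.
  by rewrite (twist_homog (homogZ r b0)) sgnZ_even.
have r1 (m : M) : ract m (aone A) = m.
  move: m; apply: (homog_eq (homog_grading M)) => [||j m mj]; first exact: bR.1.
  - by [].
  - by rewrite (ract_homog b0 mj) mul0r sgnZ_even // (dgm_act1 (dgmP M)).
case: x => a m; rewrite /cone_mul /= t1 (linear0' (twist_linear (C := M))).
rewrite (linear0' (bR.1 _)) (linear0' (bmu.1 _)) (linear0' (bmu.2 _)).
rewrite (linear0' (bact.2 _)) (bilinZl _ _ _ bact) (bilinZr _ _ _ bR).
rewrite (bilinZl _ _ _ bA) (bilinZr _ _ _ bA) (dgm_act1 (dgmP M)) r1.
by rewrite (dga_mul1l dA) (dga_mul1r dA) !(add0r, addr0).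
Qed.

(** In the [A]-component the identity follows from the Leibniz rule of [A], the [A]-linearity of
    [beta] and $\beta\mu=0$. In the [M]-component the homotopy replaces $\partial\mu$ by
    $\theta-\mu\partial$, and the two terms of $\theta$ are the ones that [beta] contributes through
    the differentials of [x] and [y]. *)
Lemma cone_mul_leibniz :
  (forall x : tensor M M, cd (mu x) + mu (cd x) = theta beta x) ->
  (forall x : tensor M M, beta (mu x) = 0) ->
  forall i j (x y : cone beta), x \in homog i -> y \in homog j ->
  cd (cone_mul x y) = cone_mul (cd x) y + sgn R i *: cone_mul x (cd y).
Proof.
move=> mu_homotopy beta_mu i j x y xi yj; have := cd_homog xi.
case: x y xi yj => [a m] [b n] /andP[/= ai mi] /andP[/= bj nj] /andP[/= dai dmi].
rewrite (cone_mul_homogE _ _ ai mi) /= /cone_cd /=.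
rewrite (cone_mul_homogE _ _ dai dmi) (cone_mul_homogE _ _ ai mi).
congr pair => /=.
  rewrite (dga_leibniz (dgaP A) ai bj) !(linearD' lbeta) !(linearZ' lbeta).
  rewrite dgh_ract dgh_act beta_mu scaler0 addr0.
  rewrite (bilinDl _ _ _ bA) (bilinDr _ _ _ bA) scalerDr.
  by rewrite [LHS](AC (2*2) (1*3*(2*4))).
have lcd := @cd_linear R M.
rewrite !(linearD' lcd) !(linearZ' lcd) cd_ract (dgm_leibniz (dgmP M) ai nj) (twist_homog mi).
have := mu_homotopy (m \ox n); rewrite thetaE /= (tens_cd_homog _ mi).
rewrite (linearD' (alin_linear mu_Alinear)) (linearZ' (alin_linear mu_Alinear)).
move=> /(canRL (addrK _)) ->.
rewrite !(bilinDl _ _ _ bR, bilinDr _ _ _ bR, bilinDl _ _ _ bact, bilinDr _ _ _ bact).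
rewrite !(linearN' (bR.1 _), linearN' (bact.2 _), linearN' (bmu.1 _), linearN' (bmu.2 _)).
rewrite !(bilinZl _ _ _ bR, bilinZr _ _ _ bact, bilinZl _ _ _ bmu, bilinZr _ _ _ bmu).
rewrite !(scalerDr, opprD, scalerN, opprK, sgnZ).
rewrite [LHS](AC (2*2*(2*2)) (1*(3*6)*7*(2*5*4*8))).
congr (_ + (_ + _) + _ + (_ + _ + _ + _)).
- by apply/esym/eq_sgnZN => //; parity.
- by apply: eq_sgnZN => //; parity.
- by apply/esym/eq_sgnZN => //; parity.
- by apply/esym/eq_sgnZN => //; parity.
- by apply: eq_sgnZN => //; parity.
Qed.

(** * Low degrees of the cone, and assembly of the dg algebra *)

Hypothesis M_neg : forall (i : int) (m : M), i < 0 -> m \in homog i -> m = 0.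

Lemma cone_neg i (x : cone beta) : i < 0 -> x \in homog i -> x = 0.
Proof.
case: x => a m i0 /andP[/= ai mi].
by rewrite (dga_neg (dgaP A) i0 ai) (M_neg _ mi) //; lia.
Qed.

Lemma cone_deg0 (x : cone beta) : x \in homog 0 ->
  exists! r : R, x = r *: ((aone A, 0) : cone beta).
Proof.
(* The second component lies in $M_{-1}=0$, so $C_0$ is $A_0$. *)
case: x => a m /andP[/= a0 m0]; rewrite (M_neg _ m0) //.
have [r [-> ur]] := dga_deg0 (dgaP A) a0; exists r; split.
  by congr pair; rewrite /= scaler0.
by move=> s [e _]; apply: ur.
Qed.

Lemma cone_is_dga :
  (forall x : tensor M M, cd (mu x) + mu (cd x) = theta beta x) ->
  (forall x : tensor M M, beta (mu x) = 0) ->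
  (forall (i j k : int) (m n u : M),
      m \in homog i -> n \in homog j -> u \in homog k ->
      mu (mu (m \ox n) \ox u) = - (sgn R i *: mu (m \ox mu (n \ox u)))) ->
  is_dga (C := cone beta) (aone A, 0) cone_mul.
Proof.
move=> mu_homotopy beta_mu mu_assoc.
have mul1 := cone_mul_one 1; rewrite scale1r in mul1.
split.
- exact: cone_neg.
- exact: cone_mul_bilin.
- exact: cone_mulA.
- by move=> x; rewrite (mul1 x).1 scale1r.
- by move=> x; rewrite (mul1 x).2 scale1r.
- by apply/andP; split; [exact: dga_one (dgaP A)|exact: homog0].
- exact: cone_deg0.
- exact: cone_mul_homog.
- exact: cone_mul_leibniz.
Qed.

End ConeProduct.

Theorem mainTheorem1 (R : comPzRingType) (A : cdgAlgebra R) (M : dgModule A)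
    (M_neg : forall (i : int) (m : M), i < 0 -> m \in homog i -> m = 0)
    (beta : dgHom M (regular A))
    (mu : tensor M M -> M)
    (mu_Alinear : Alinear 1 mu)
    (mu_homotopy : forall x : tensor M M, cd (mu x) + mu (cd x) = theta beta x)
    (beta_mu : forall x : tensor M M, beta (mu x) = 0)
    (mu_assoc : forall (i j k : int) (m n u : M),
      m \in homog i -> n \in homog j -> u \in homog k ->
      mu (mu (m \ox n) \ox u) = - (sgn R i *: mu (m \ox mu (n \ox u)))) :
  exists mul : cone beta -> cone beta -> cone beta,
    [/\ (* the product of homogeneous elements of degree at least 1 *)
        forall (i j : int) (a b : A) (m n : M), 1 <= i -> 1 <= j ->
          ((a, m) : cone beta) \in homog i -> ((b, n) : cone beta) \in homog j ->
          mul (a, m) (b, n) =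
            (amul a b,
             ract m b + sgn R i *: act a n + sgn R (i - 1) *: mu (m \ox n)),
        (* the product with elements of C_0 = R *)
        forall (r : R) (x : cone beta),
          mul (r *: aone A, 0) x = r *: x /\ mul x (r *: aone A, 0) = r *: x,
        is_dga (C := cone beta) (aone A, 0) mul &
        (forall (i j : int) (m n : M), m \in homog i -> n \in homog j ->
           mu (m \ox n) = - (sgn R (i * j) *: mu (n \ox m))) ->
        graded_commutative mul /\
        (strictly_commutative (@amul R A) ->
         (forall (i : int) (m : M), m \in homog i -> ~~ odd `|i| ->
            mu (m \ox m) = 0) ->
         strictly_commutative mul)].
Proof.
exists (cone_mul mu); split.
- move=> i j a b m n _ _ /andP[/= ai mi] _; exact: cone_mul_homogE.
- exact: cone_mul_one.
- exact: cone_is_dga.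
move=> muC; split=> [|[_ sqrA] sqrM]; first exact: cone_mulC.
by split; [exact: cone_mulC|exact: cone_mul_sqr_odd].
Qed.
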